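(* Let $a_0,a_1,c_0,c_1$ be non-negative integers, $a=a_0+a_1$, $c=c_0+c_1$. Let $\alpha,\beta\in\binom{[a]}{a_1}$ and $\gamma,\delta\in\binom{[c]}{c_1}$. Then $$\mathrm{Par}_T(\alpha,\gamma,\beta,\delta)=\mathrm{Par}_T(\beta,\gamma,\alpha,\delta)=\mathrm{Par}_T(\alpha,\delta,\beta,\gamma)=\mathrm{Par}_T(\beta,\delta,\alpha,\gamma),$$ where $\mathrm{Par}_T(\alpha,\gamma,\beta,\delta)$ is the number of parallelogram-shaped equivariant puzzles with SW, NW, NE, SE labels $\alpha,\gamma,\beta,\delta$.
   Context: Strings: $\binom{[n]}{k}$ denotes the set of binary strings (words in the symbols $0,1$) of length $n$ with exactly $k$ ones. Equivariant puzzles: work in the triangular lattice in the plane, whose unit edges make angles $0^\circ,60^\circ,120^\circ$ with the $x$-axis. Edge labels are the three symbols $0$, $1$, $10$ (where $10$ is a single symbol). The allowed pieces are: (i) unit triangles (upward- or downward-pointing) whose three edge labels read clockwise are $(0,0,0)$, $(1,1,1)$, or a cyclic rotation of $(1,0,10)$; (ii) the equivariant piece: the unit rhombus formed by an upward-pointing unit triangle glued along its horizontal edge to the downward-pointing unit triangle below it (the horizontal edge being removed), with NW, NE, SE, SW edges labeled $0,1,0,1$ respectively; this piece may not be rotated. Given a convex lattice polygon whose sides are labeled by binary strings, one symbol per unit edge, read clockwise around the polygon, an equivariant puzzle with this boundary is a tiling of the polygon by allowed pieces such that any two glued edges have the same label and the labels on the boundary are the prescribed ones. $\mathrm{Par}_T(\alpha,\gamma,\beta,\delta)$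 is the number of equivariant puzzles on the parallelogram with sides, in clockwise order, SW (length $a$), NW (length $c$), NE (length $a$), SE (length $c$), with top and bottom angles $60^\circ$, labeled respectively $\alpha,\gamma,\beta,\delta$, each read clockwise. *)

(* Defs.v *)
From HB Require Import structures.
From mathcomp Require Import all_boot.

Set Implicit Arguments.
Unset Strict Implicit.
Unset Printing Implicit Defensive.

(* L10 is the single symbol 10. *)
Inductive label := L0 | L1 | L10.

Definition label_code (l : label) : option bool :=
  match l with L0 => Some false | L1 => Some true | L10 => None end.

Definition label_decode (o : option bool) : label :=
  match o with Some false => L0 | Some true => L1 | None => L10 end.

Lemma label_codeK : cancel label_code label_decode.
Proof. by case. Qed.

HB.instance Definition _ := Finite.copy label (can_type label_codeK).

(* A binary string of length n is an n.-tuple bool, true being the symbol 1. *)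
Definition bit_label (b : bool) : label := if b then L1 else L0.

Definition binstr (n k : nat) : {set n.-tuple bool} :=
  [set s : n.-tuple bool | count_mem true s == k].

(* The labels of a unit triangle, of either orientation, read clockwise. *)
Definition triangle_piece (x y z : label) : bool :=
  (x, y, z) \in [:: (L0, L0, L0); (L1, L1, L1);
                    (L1, L0, L10); (L0, L10, L1); (L10, L1, L0)].

Definition equivariant_piece (nw ne se sw : label) : bool :=
  [&& nw == L0, ne == L1, se == L0 & sw == L1].

(* Coordinates on the parallelogram.  Let u be the unit vector at angle -60
   degrees, v the unit vector at angle 60 degrees, and put the origin at the
   left corner, so that the parallelogram is
     { s u + t v | 0 <= s <= a, 0 <= t <= c },
   with 60 degree angles at its top corner c v and its bottom corner a u.  The
   lattice edges lying in it are
     D (i, j) : from i u + j v to (i+1) u + j v         (i < a, j <= c),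
     U (i, j) : from i u + j v to i u + (j+1) v         (i <= a, j < c),
     H (i, j) : from i u + j v to (i+1) u + (j+1) v     (i < a, j < c);
   the edges H are horizontal because u + v = (1, 0).
   The unit cell (i, j) is the rhombus with
     NW edge U (i, j), NE edge D (i, j+1), SE edge U (i+1, j), SW edge D (i, j);
   its diagonal H (i, j) cuts it into an upward-pointing triangle above and a
   downward-pointing triangle below.  As the equivariant piece cannot be
   rotated, it can only be placed on one of these cells.  A tiling is thus
   recorded by the labels of all its edges: H (i, j) is None when the cell
   (i, j) is an equivariant piece (its horizontal edge is removed), and Some h
   when it consists of two triangles glued along an edge labeled h.  Recording
   one label per edge enforces that glued edges carry the same label. *)
Definition edge_labeling (a c : nat) : finType :=
  ({ffun 'I_a * 'I_c.+1 -> label} * {ffun 'I_a.+1 * 'I_c -> label}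
     * {ffun 'I_a * 'I_c -> option label})%type.

Section Puzzle.
Variables (a c : nat) (P : edge_labeling a c).

Definition edgeD (i : 'I_a) (j : 'I_c.+1) : label := P.1.1 (i, j).
Definition edgeU (i : 'I_a.+1) (j : 'I_c) : label := P.1.2 (i, j).
Definition edgeH (i : 'I_a) (j : 'I_c) : option label := P.2 (i, j).

(* widen_ord and lift ord0 are k |-> k and k |-> k+1 from 'I_n to 'I_n.+1. *)
Definition cell_NW (i : 'I_a) (j : 'I_c) := edgeU (widen_ord (leqnSn a) i) j.
Definition cell_NE (i : 'I_a) (j : 'I_c) := edgeD i (lift ord0 j).
Definition cell_SE (i : 'I_a) (j : 'I_c) := edgeU (lift ord0 i) j.
Definition cell_SW (i : 'I_a) (j : 'I_c) := edgeD i (widen_ord (leqnSn c) j).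

Definition cell_ok (i : 'I_a) (j : 'I_c) : bool :=
  match edgeH i j with
  | Some h => triangle_piece (cell_NW i j) (cell_NE i j) h
              && triangle_piece h (cell_SE i j) (cell_SW i j)
  | None => equivariant_piece (cell_NW i j) (cell_NE i j)
                              (cell_SE i j) (cell_SW i j)
  end.

Definition is_puzzle : bool := [forall i, forall j, cell_ok i j].

(* Every side is read clockwise: SW from the bottom corner to the left one, NW
   from left to top, NE from top to right, SE from right to bottom.  Hence the
   SW and SE sides are traversed against u and v respectively. *)
Definition has_boundary (alpha : a.-tuple bool) (gamma : c.-tuple bool)
    (beta : a.-tuple bool) (delta : c.-tuple bool) : bool :=
  [&& [forall k : 'I_a, edgeD (rev_ord k) ord0 == bit_label (tnth alpha k)],
      [forall k : 'I_c, edgeU ord0 k == bit_label (tnth gamma k)],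
      [forall k : 'I_a, edgeD k ord_max == bit_label (tnth beta k)]
    & [forall k : 'I_c, edgeU ord_max (rev_ord k) == bit_label (tnth delta k)]].

End Puzzle.

Definition ParT (a c : nat) (alpha : a.-tuple bool) (gamma : c.-tuple bool)
    (beta : a.-tuple bool) (delta : c.-tuple bool) : nat :=
  #|[set P : edge_labeling a c |
      is_puzzle P && has_boundary P alpha gamma beta delta]|.

(* Main.v *)
(** Give the equivariant piece a weight s_j depending on the strip
    of cells (i, j), 0 <= i < a, it lies in, so that a puzzle count becomes an
    entry of a product of strip kernels.  Two adjacent strips of
    weights s, t satisfy a Yang-Baxter relation whose R-matrix
    1 + (s - t) N has N nilpotent, N moving a pair of end labels (x, x') with
    x > x' to (x', x) for the order 1 > 10 > 0.  When the weights are pairwise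
    distinct this relation expresses the count for NW label gamma by counts for
    NW labels in which an adjacent pair 01 is sorted to 10, which reduces the exchange of alpha and
    beta to gamma = 1...10...0.  There the strips starting with 1 act as the
    identity on binary strings, and the strips with both ends 0 commute and are
    individually invariant under the half turn.  Distinct weights are obtained
    in Z[X], and setting X = 0 makes all of them equal to 1.  The remaining
    equalities come from the half turn of the whole parallelogram. *)
Require Import Defs.
From mathcomp Require Import all_boot all_order all_algebra.
From mathcomp Require Import ring zify.

Set Implicit Arguments.
Unset Strict Implicit.
Unset Printing Implicit Defensive.

Import GRing.Theory.
Local Open Scope ring_scope.

(** * Products of square matrices indexed by a finite type *)

Section Kernels.
Variable R : comNzRingType.
Implicit Types (X Y I : finType).

Definition kmul X (M N : X -> X -> R) (x y : X) : R := \sum_z M x z * N z y.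

Fixpoint kprod X (Ms : seq (X -> X -> R)) (x y : X) : R :=
  if Ms is M :: Ms' then kmul M (kprod Ms') x y else (x == y)%:R.

Lemma sum_eq_mull X (f : X -> R) x : \sum_z (x == z)%:R * f z = f x.
Proof.
rewrite (bigD1 x) //= eqxx mul1r big1 ?addr0 // => z zx.
by rewrite eq_sym (negbTE zx) mul0r.
Qed.

Lemma sum_eq_mulr X (f : X -> R) y : \sum_z f z * (z == y)%:R = f y.
Proof.
rewrite (bigD1 y) //= eqxx mulr1 big1 ?addr0 // => z zy.
by rewrite (negbTE zy) mulr0.
Qed.

Lemma eq_kmul X (M M' N N' : X -> X -> R) x y :
  (forall z, M x z = M' x z) -> (forall z, N z y = N' z y) ->
  kmul M N x y = kmul M' N' x y.
Proof. by move=> EM EN; apply: eq_bigr => z _; rewrite EM EN. Qed.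

Lemma kmulA X (M N P : X -> X -> R) x y :
  kmul M (kmul N P) x y = kmul (kmul M N) P x y.
Proof.
rewrite /kmul; under eq_bigr do rewrite mulr_sumr.
rewrite exchange_big /=; apply: eq_bigr => z _; rewrite mulr_suml.
by apply: eq_bigr => w _; rewrite mulrA.
Qed.

Lemma eq_kprod X (T : eqType) (f g : T -> X -> X -> R) s x y :
  {in s, forall i x y, f i x y = g i x y} ->
  kprod [seq f i | i <- s] x y = kprod [seq g i | i <- s] x y.
Proof.
elim: s x => //= i s IHs x Efg; apply: eq_kmul => z.
  by rewrite Efg ?mem_head.
by apply: IHs => j js; apply: Efg; rewrite inE js orbT.
Qed.

Lemma kprod_cat X (Ms Ns : seq (X -> X -> R)) x y :
  kprod (Ms ++ Ns) x y = kmul (kprod Ms) (kprod Ns) x y.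
Proof.
elim: Ms x => [|M Ms IHs] x /=; first by rewrite /kmul sum_eq_mull.
by rewrite -kmulA; apply: eq_kmul.
Qed.

Lemma kprod1 X (M : X -> X -> R) x y : kprod [:: M] x y = M x y.
Proof. exact: sum_eq_mulr. Qed.

Lemma kprod_rcons X (Ms : seq (X -> X -> R)) M x y :
  kprod (rcons Ms M) x y = kmul (kprod Ms) M x y.
Proof. by rewrite -cats1 kprod_cat; apply: eq_kmul => // z; rewrite kprod1. Qed.

Lemma kprod_tr X (T : Type) (f : T -> X -> X -> R) s x y :
  kprod [seq (fun x y => f i y x) | i <- s] x y
  = kprod [seq f i | i <- rev s] y x.
Proof.
elim: s x => [|i s IHs] x /=; first by rewrite eq_sym.
rewrite rev_cons map_rcons kprod_rcons; apply: eq_bigr => z _.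
by rewrite IHs mulrC.
Qed.

Lemma kprod_conj X (T : Type) (f : T -> X -> X -> R) (h : X -> X) s x y :
  involutive h ->
  kprod [seq (fun x y => f i (h x) (h y)) | i <- s] x y
  = kprod [seq f i | i <- s] (h x) (h y).
Proof.
move=> hK; elim: s x => [|i s IHs] x /=; first by rewrite (inj_eq (inv_inj hK)).
rewrite /kmul [RHS](reindex_inj (inv_inj hK)) /=.
by apply: eq_bigr => z _; rewrite IHs.
Qed.

(** [Q] is carried past one factor at a time. This later propagates a local exchange relation along
    a whole strip. *)
Lemma kprod_intertwine X (T : eqType) (Q : X -> X -> R)
    (f g : T -> X -> X -> R) s x y :
  {in s, forall i x y, kmul Q (f i) x y = kmul (g i) Q x y} ->
  kmul Q (kprod [seq f i | i <- s]) x y = kmul (kprod [seq g i | i <- s]) Q x y.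
Proof.
elim: s x => [|i s IHs] x EQ /=; first by rewrite /kmul sum_eq_mull sum_eq_mulr.
rewrite kmulA.
transitivity (kmul (kmul (g i) Q) (kprod [seq f j | j <- s]) x y).
  by apply: eq_kmul => // z; rewrite EQ ?mem_head.
rewrite -!kmulA; apply: eq_kmul => // z.
by apply: IHs => j js; apply: EQ; rewrite inE js orbT.
Qed.

Lemma kprod_rev_comm X (T : eqType) (f : T -> X -> X -> R) s x y :
  (forall i j x y, kmul (f i) (f j) x y = kmul (f j) (f i) x y) ->
  kprod [seq f i | i <- rev s] x y = kprod [seq f i | i <- s] x y.
Proof.
move=> fC; elim: s x y => //= i s IHs x y.
rewrite rev_cons map_rcons kprod_rcons.
transitivity (kmul (kprod [seq f j | j <- s]) (f i) x y); first exact: eq_kmul.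
by symmetry; apply: kprod_intertwine => j _ u v; apply: fC.
Qed.

(** The mixed-product rule for Kronecker products, read entrywise. *)
Lemma kprod_tensor X Y (T : Type) (f : T -> X -> X -> R) (g : T -> Y -> Y -> R)
    s x y :
  kprod [seq f i | i <- s] x.1 y.1 * kprod [seq g i | i <- s] x.2 y.2
  = kprod [seq (fun u v => f i u.1 v.1 * g i u.2 v.2) | i <- s] x y.
Proof.
elim: s x => [|i s IHs] x /=; first by rewrite -natrM mulnb.
rewrite /kmul big_distrlr pair_big /=; apply: eq_bigr => z _.
by rewrite mulrACA IHs.
Qed.

(** Expansion of a matrix product over paths. The induction splits off the first vertex of the path,
    which [glue] puts back. *)
Lemma kprod_paths X n (M : 'I_n -> X -> X -> R) x y :
  \sum_(u : {ffun 'I_n.+1 -> X} | (u ord0 == x) && (u ord_max == y))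
     \prod_(i < n) M i (u (widen_ord (leqnSn n) i)) (u (lift ord0 i))
  = kprod [seq M i | i <- enum 'I_n] x y.
Proof.
elim: n M x => [|n IHn] M x.
  rewrite enum_ord0 /=; under eq_bigr do rewrite big_ord0.
  rewrite (eq_bigl (fun u => (u == [ffun=> x]) && (x == y))); last first.
    move=> u; have -> : (@ord_max 0) = ord0 by apply: val_inj.
    apply/andP/andP => [[/eqP <- /eqP <-]|[/eqP -> xy]]; last by rewrite !ffunE.
    by split=> //; apply/eqP/ffunP => i; rewrite ffunE (ord1 i).
  case: (x == y); last by rewrite big_pred0 // => u; rewrite andbF.
  by under eq_bigl do rewrite andbT; rewrite big_pred1_eq.
rewrite enum_ordSl /= -map_comp /kmul.
pose glue (p : X * {ffun 'I_n.+1 -> X}) : {ffun 'I_n.+2 -> X} :=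
  [ffun i => if unlift ord0 i is Some j then p.2 j else p.1].
have glueS p j : glue p (lift ord0 j) = p.2 j by rewrite ffunE liftK.
have glue0 p : glue p ord0 = p.1 by rewrite ffunE unlift_none.
have glue_max p : glue p ord_max = p.2 ord_max.
  by rewrite -glueS; congr (glue p _); apply: val_inj.
pose cut (u : {ffun 'I_n.+2 -> X}) := (u ord0, [ffun j => u (lift ord0 j)]).
rewrite (reindex glue) /=; last first.
  exists cut => u _.
    rewrite /cut glue0; case: u => z u; congr (_, _).
    by apply/ffunP => j; rewrite ffunE glueS.
  apply/ffunP => i; case: (unliftP ord0 i) => [j|] ->.
    by rewrite glueS ffunE.
  by rewrite glue0.
under eq_bigl do rewrite glue0 glue_max.
rewrite -(pair_big (pred1 x) (fun u : {ffun 'I_n.+1 -> X} => u ord_max == y)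
  (fun z u => \prod_(i < n.+1) M i (glue (z, u) (widen_ord (leqnSn n.+1) i))
                                   (glue (z, u) (lift ord0 i)))) /=.
rewrite big_pred1_eq.
rewrite (partition_big (fun u : {ffun 'I_n.+1 -> X} => u ord0) predT) //=.
apply: eq_bigr => z _; rewrite -IHn big_distrr /=.
apply: eq_big => [u|u /andP[_ /eqP <-]]; first by rewrite andbC.
rewrite big_ord_recl glueS /=.
have -> : widen_ord (leqnSn n.+1) ord0 = ord0 by apply: val_inj.
rewrite glue0; congr (_ * _); apply: eq_bigr => i _.
rewrite glueS /=; congr (M _ _ _); rewrite -(glueS (x, u)); congr (glue _ _).
exact: val_inj.
Qed.

(** Along a fixed path each choice [B i] affects one factor only, so the sum over [B]
    distributes. *)
Lemma sum_kprod X Y n (K : 'I_n -> Y -> X -> X -> R) x y :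
  \sum_(B : {ffun 'I_n -> Y}) kprod [seq K i (B i) | i <- enum 'I_n] x y
  = kprod [seq (fun u v => \sum_r K i r u v) | i <- enum 'I_n] x y.
Proof.
under eq_bigr do rewrite -(kprod_paths (fun i => K i _)).
rewrite -kprod_paths exchange_big /=; apply: eq_bigr => u _.
by rewrite bigA_distr_bigA.
Qed.

End Kernels.

(** * Weights of one cell and of two glued cells *)

Lemma big_label (V : nmodType) (f : label -> V) :
  \sum_l f l = f L0 + (f L1 + f L10).
Proof.
rewrite (perm_big [:: L0; L1; L10]) /= ?big_cons ?big_nil ?addr0 //.
by apply: uniq_perm; rewrite ?index_enum_uniq // => -[]; rewrite mem_index_enum.
Qed.

Lemma big_option_label (V : nmodType) (f : option label -> V) :
  \sum_o f o = f None + \sum_l f (Some l).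
Proof.
rewrite (perm_big [:: None; Some L0; Some L1; Some L10]) /=.
  by rewrite big_label !big_cons big_nil ?addr0.
by apply: uniq_perm; rewrite ?index_enum_uniq // => -[[]|];
  rewrite mem_index_enum.
Qed.

Section Rows.
Variable R : comNzRingType.

(* With NW and SE last, [site s sw ne] is a kernel on the labels met along a
   strip. *)
Definition site (s : R) (sw ne nw se : label) : R :=
  (\sum_h (triangle_piece nw ne h && triangle_piece h se sw) : nat)%:R
  + s * (equivariant_piece nw ne se sw)%:R.

Definition site_table (s : R) (sw ne nw se : label) : R :=
  match nw, sw, ne, se with
  | L0, L1, L1, L0 => s
  | L0, L0, L0, L0 | L0, L1, L0, L10 | L0, L1, L10, L1 | L0, L10, L10, L0
  | L1, L0, L0, L1 | L1, L1, L1, L1 | L1, L10, L1, L0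
  | L10, L0, L1, L0 | L10, L1, L1, L10 => 1
  | _, _, _, _ => 0
  end.

(** Two labels of a triangle determine the third, so at most one [h] fits; NW, NE labels 0, 1 fit no
    triangle and leave only the equivariant piece. *)
Lemma siteE s sw ne nw se : site s sw ne nw se = site_table s sw ne nw se.
Proof.
rewrite /site (big_label (fun h => (_ && _ : nat))).
by case: sw; case: ne; case: nw; case: se;
  rewrite /= ?mulr0 ?mulr1 ?addr0 ?add0r.
Qed.

(** A half turn of the cell exchanges its two triangles, whose allowed clockwise labels are the
    same, and preserves the equivariant piece. *)
Lemma site_rot s sw ne nw se : site s sw ne nw se = site s ne sw se nw.
Proof. by rewrite !siteE; case: sw; case: ne; case: nw; case: se. Qed.

(** Cells [(i, j)] and [(i, j+1)] glued along an edge labeled [r]: [p] and [q] are the outer SW and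
    NE labels, [x] and [y] the pairs of NW and SE labels. *)
Definition site2 (s t : R) (p q : label) (x y : label * label) : R :=
  \sum_r site s p r x.1 y.1 * site t r q x.2 y.2.

Definition swap (x : label * label) := (x.2, x.1).

Definition descent (x : label * label) : bool :=
  x \in [:: (L1, L0); (L1, L10); (L10, L0)].

Lemma site2_exchange s t p q x y :
  site2 s t p q x y + (s - t) * (descent x)%:R * site2 s t p q (swap x) y
  = site2 t s p q x y
    + site2 t s p q x (swap y) * ((s - t) * (descent (swap y))%:R).
Proof.
rewrite /site2 !big_label !siteE; case: x => x1 x2; case: y => y1 y2.
case: x1; case: x2; case: y1; case: y2; case: p; case: q => /=; ring.
Qed.
End Rows.

(** * Strips, grids and their exchange relations *)

Section Strips.
Variable R : comNzRingType.

Definition rmatrix (z : R) (x y : label * label) : R :=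
  (x == y)%:R + z * (descent x)%:R * (swap x == y)%:R.

Lemma swapK : involutive swap.
Proof. by case. Qed.

Lemma kmul_rmatrixl z M x y :
  kmul (rmatrix z) M x y = M x y + z * (descent x)%:R * M (swap x) y.
Proof.
rewrite /kmul; under eq_bigr do rewrite mulrDl -mulrA.
by rewrite big_split /= -mulr_sumr !sum_eq_mull.
Qed.

Lemma kmul_rmatrixr z M x y :
  kmul M (rmatrix z) x y
  = M x y + M x (swap y) * (z * (descent (swap y))%:R).
Proof.
rewrite /kmul; under eq_bigr => w do
  rewrite mulrDr (can2_eq swapK swapK) (mulrA (M x w)).
rewrite big_split /= sum_eq_mulr.
by rewrite (sum_eq_mulr (fun w => M x w * (z * (descent w)%:R))).
Qed.

Section Width.
Variable a : nat.
Notation conf := {ffun 'I_a -> label}.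
Implicit Types A B C : conf.

(** Built as a matrix product in the end labels [x] (NW) and [y] (SE); for fixed ends it is in turn
    a matrix from SW labels [A] to NE labels [B]. *)
Definition strip (s : R) (x y : label) A B : R :=
  kprod [seq site s (A i) (B i) | i <- enum 'I_a] x y.

Definition strip2 (s t : R) (x y : label * label) A C : R :=
  kmul (strip s x.1 y.1) (strip t x.2 y.2) A C.

(** The labels between the two strips are summed independently in each cell, so the pair can be
    multiplied cell pair by cell pair. *)
Lemma strip2E s t x y A C :
  strip2 s t x y A C = kprod [seq site2 s t (A i) (C i) | i <- enum 'I_a] x y.
Proof.
rewrite -(sum_kprod
  (fun i r u v => site s (A i) r u.1 v.1 * site t r (C i) u.2 v.2)).
by apply: eq_bigr => B _; rewrite kprod_tensor.
Qed.

(** The R-matrix passes through the cell pairs by [site2_exchange], entering at the NW ends and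
    leaving at the SE ends. *)
Lemma strip2_exchange s t x y A C :
  strip2 s t x y A C + (s - t) * (descent x)%:R * strip2 s t (swap x) y A C
  = strip2 t s x y A C
    + strip2 t s x (swap y) A C * ((s - t) * (descent (swap y))%:R).
Proof.
rewrite !strip2E -kmul_rmatrixl -kmul_rmatrixr.
apply: kprod_intertwine => i _ u v.
by rewrite kmul_rmatrixl kmul_rmatrixr site2_exchange.
Qed.

Definition flip A : conf := [ffun i => A (rev_ord i)].

Lemma flipK : involutive flip.
Proof. by move=> A; apply/ffunP => i; rewrite !ffunE rev_ordK. Qed.

Lemma rev_enum_ord : rev (enum 'I_a) = [seq rev_ord i | i <- enum 'I_a].
Proof.
apply: (inj_map val_inj); rewrite map_rev val_enum_ord.
apply: (@eq_from_nth _ 0%N) => [|i].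
  by rewrite size_rev size_iota 2!size_map size_enum_ord.
rewrite size_rev size_iota => ia; rewrite nth_rev ?size_iota //.
rewrite nth_iota; last first.
  exact: rev_ord_proof (Ordinal ia).
rewrite (nth_map (Ordinal ia)); last by rewrite size_map size_enum_ord.
rewrite (nth_map (Ordinal ia)) /=; last by rewrite size_enum_ord.
by rewrite nth_enum_ord.
Qed.

(** Half turn of a strip: [site_rot] turns each cell, and the cells are then met in reverse
    order. *)
Lemma strip_flip s x y A B : strip s x y A B = strip s y x (flip B) (flip A).
Proof.
rewrite {2}/strip; under eq_map do rewrite !ffunE.
rewrite (map_comp (fun i => site s (B i) (A i)) (@rev_ord a)) -rev_enum_ord.
rewrite -kprod_tr; apply: eq_kprod => i _ u v; exact: site_rot.
Qed.

(* The weight of a strip, then its labels on the NW and SE sides. *)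
Definition grid_row : Type := R * (bool * bool).

Definition grid (rows : seq grid_row) : conf -> conf -> R :=
  kprod [seq strip w.1 (bit_label w.2.1) (bit_label w.2.2) | w <- rows].

(** [strip2_exchange] inside a longer product, by linearity. The [d] term trades the NW labels of
    the two strips, the [e] term their SE labels. *)
Lemma grid_exchange r1 r2 (s t : R) (x1 x2 y1 y2 : bool) A B :
  let d := (s - t) * (descent (bit_label x1, bit_label x2))%:R in
  let e := (s - t) * (descent (bit_label y2, bit_label y1))%:R in
  grid (r1 ++ (s, (x1, y1)) :: (t, (x2, y2)) :: r2) A B
  + d * grid (r1 ++ (s, (x2, y1)) :: (t, (x1, y2)) :: r2) A B
  = grid (r1 ++ (t, (x1, y1)) :: (s, (x2, y2)) :: r2) A B
    + e * grid (r1 ++ (t, (x1, y2)) :: (s, (x2, y1)) :: r2) A B.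
Proof.
move=> d e; elim: r1 A => [|w r1 IHr] A.
  have E u v (x y : bool * bool) :
    grid [:: (u, (x.1, y.1)), (v, (x.2, y.2)) & r2] A B
    = kmul (strip2 u v (bit_label x.1, bit_label x.2)
                       (bit_label y.1, bit_label y.2))
            (grid r2) A B.
    by rewrite /grid /= kmulA.
  rewrite /= (E s t (x1, x2) (y1, y2)) (E s t (x2, x1) (y1, y2)).
  rewrite (E t s (x1, x2) (y1, y2)) (E t s (x1, x2) (y2, y1)) /=.
  rewrite /kmul !mulr_sumr -!big_split /=; apply: eq_bigr => C _.
  rewrite !mulrA -!mulrDl; congr (_ * _).
  by rewrite (mulrC e) -strip2_exchange.
rewrite /grid /= -/(grid _) /kmul !mulr_sumr -!big_split /=.
apply: eq_bigr => C _; have := IHr C.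
by rewrite /grid !(mulrCA _ (strip _ _ _ _ _)) -!mulrDr => ->.
Qed.

End Width.
End Strips.

(** * Exchange symmetry of grids with distinct weights *)

Lemma bitseq_swap_ind (P : seq bool -> Prop) :
  (forall k m, P (nseq k true ++ nseq m false)) ->
  (forall g1 g2, P (g1 ++ [:: true, false & g2]) ->
                 P (g1 ++ [:: false, true & g2])) ->
  forall g, P g.
Proof.
move=> Psorted Pswap.
(* One insertion of an insertion sort: a 0 is moved across a block of 1s by adjacent swaps. *)
have Pshift k g1 g2 : P (g1 ++ nseq k true ++ false :: g2) ->
    P (g1 ++ false :: nseq k true ++ g2).
  elim: k g1 => //= k IHk g1; rewrite -cat_rcons => /IHk.
  by rewrite cat_rcons; apply: Pswap.
suff Psort g g1 : P (g1 ++ nseq (count_mem true g) true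
                       ++ nseq (count_mem false g) false) -> P (g1 ++ g).
  by move=> g; apply: (Psort g [::]); apply: Psorted.
elim: g g1 => //= -[] g IHg g1; rewrite ?add0n ?add1n /=.
  by rewrite -!cat_rcons; apply: IHg.
by move/Pshift; rewrite -!cat_rcons; apply: IHg.
Qed.

Section Symmetry.
Variables (R : comNzRingType) (a : nat).
Notation conf := {ffun 'I_a -> label}.
Implicit Types (A B : conf) (rows : seq (grid_row R)).

Definition is_binary A := forall i, A i != L10.

(** The SW side is read clockwise against the index [i], so exchanging alpha and beta replaces
    [(A, B)] by [(flip B, flip A)]. Unlike in a half turn, the strips and their ends stay in
    place. *)
Definition flip_symmetric rows := forall A B,
  is_binary A -> is_binary B -> grid rows A B = grid rows (flip B) (flip A).

Lemma flip_binary A : is_binary A -> is_binary (flip A).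
Proof. by move=> bA i; rewrite ffunE. Qed.

(** With NW label 1 and SW label 0 or 1, a cell must have NE equal to SW and SE equal to 1, so the 1
    propagates. A SW label 10 would break this. *)
Lemma strip_left1 s y A B : is_binary A ->
  strip s L1 y A B = ((L1 == y) && (A == B))%:R :> R.
Proof.
move=> bA; have -> : (A == B) = all (fun i => A i == B i) (enum 'I_a).
  apply/eqP/allP => [-> //|AB]; apply/ffunP => i.
  by apply/eqP/AB; rewrite mem_enum.
rewrite /strip; elim: (enum _) => [|i r IHr] /=; first by rewrite andbT.
transitivity
  ((A i == B i)%:R * ((L1 == y) && all (fun i => A i == B i) r)%:R : R).
  rewrite -IHr -(sum_eq_mull (fun z => _ * kprod _ z y)).
  apply: eq_bigr => z _; rewrite mulrA; congr (_ * _); rewrite siteE.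
  by move: (bA i); case: (A i); case: (B i); case: z; rewrite //= ?mulr0 ?mulr1.
by rewrite -natrM mulnb andbCA.
Qed.

Lemma grid_left1 s y rows A B : is_binary A ->
  grid ((s, (true, y)) :: rows) A B = (y%:R : R) * grid rows A B.
Proof.
move=> bA; rewrite {1}/grid /= /kmul.
under eq_bigr do rewrite strip_left1 // -mulnb natrM -mulrA.
by rewrite -mulr_sumr sum_eq_mull; case: y.
Qed.

(** The pair [(L0, L0)] is no descent, so the exchange relation reduces to commutation. Flipping
    every strip reverses the product, and commutation restores its order. *)
Lemma grid_zero_flip (ss : seq R) A B :
  let rows := [seq (s, (false, false)) | s <- ss] in
  grid rows A B = grid rows (flip B) (flip A).
Proof.
rewrite /grid /= -!map_comp.
have comm s t A' B' : kmul (@strip R a s L0 L0) (@strip R a t L0 L0) A' B'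
    = kmul (strip t L0 L0) (strip s L0 L0) A' B'.
  have := strip2_exchange s t (L0, L0) (L0, L0) A' B'.
  have -> : swap (L0, L0) = (L0, L0) by [].
  have -> : descent (L0, L0) = false by [].
  by rewrite mulr0n !mulr0 mul0r !addr0.
rewrite -(kprod_rev_comm _ _ _ comm) -kprod_tr -(kprod_conj _ _ _ _ (@flipK a)).
by apply: eq_kprod => s _ A' B'; rewrite strip_flip.
Qed.

(** Leading strips with NW label 1 are peeled off; one with SE label 0 makes both sides vanish.
    Otherwise all SE labels 1 are used up with the NW ones, and only strips with both ends 0
    remain. *)
Lemma grid_sorted_flip rows k m :
  [seq w.2.1 | w <- rows] = nseq k true ++ nseq m false ->
  count_mem true [seq w.2.2 | w <- rows] = k -> flip_symmetric rows.
Proof.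
move=> Eleft Eright A B bA bB.
elim: k rows Eleft Eright => [|k IHk] /= rows; last first.
  case: rows => // -[s [x y]] rows [-> Eleft] /= Eright.
  rewrite !grid_left1 //; last exact: flip_binary.
  case: y Eright => [[Eright]|_]; last by rewrite !mul0r.
  by rewrite (IHk rows).
move=> Eleft Eright.
suff -> : rows = [seq (s, (false, false)) | s <- [seq w.1 | w <- rows]].
  exact: grid_zero_flip.
rewrite -map_comp -[LHS]map_id; apply/eq_in_map => -[s [x y]] /= w_in.
have -> : x = false.
  have : x \in nseq m false.
    by rewrite -Eleft; apply/mapP; exists (s, (x, y)).
  by case/nseqP.
suff -> : y = false by [].
apply/negbTE/negP => yT; move/eqP: Eright.
rewrite eqn0Ngt -has_count => /hasP[]; exists true => //.
by apply/mapP; exists (s, (x, y)).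
Qed.

End Symmetry.

Lemma grid_flip (R : idomainType) (a : nat) (rows : seq (grid_row R)) :
  uniq [seq w.1 | w <- rows] ->
  count_mem true [seq w.2.1 | w <- rows]
    = count_mem true [seq w.2.2 | w <- rows] ->
  flip_symmetric a rows.
Proof.
have [g Eg] := ex_intro (fun g => [seq w.2.1 | w <- rows] = g) _ erefl.
elim/bitseq_swap_ind: g rows Eg => [k m|g1 g2 IHg] rows Eg.
  move=> _; rewrite Eg count_cat !count_nseq /= mul1n mul0n addn0 => /esym.
  exact: grid_sorted_flip Eg.
have [r1 [s [t [y1 [y2 [r2 [-> Eg1 Eg2]]]]]]] : exists r1 s t y1 y2 r2,
  [/\ rows = r1 ++ [:: (s, (false, y1)), (t, (true, y2)) & r2],
      [seq w.2.1 | w <- r1] = g1 & [seq w.2.1 | w <- r2] = g2].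
  elim: g1 rows Eg {IHg} => [|b g1 IHg] [|[s [x1 y1]] rows] //=.
    case: rows => [|[t [x2 y2]] r2] //= [-> -> Eg2].
    by exists [::], s, t, y1, y2, r2.
  case=> -> /IHg[r1 [s' [t' [y1' [y2' [r2 [-> Eg1 Eg2]]]]]]].
  by exists ((s, (b, y1)) :: r1), s', t', y1', y2', r2; rewrite /= Eg1.
rewrite !map_cat /= => Us Ec A B bA bB.
have neq_st : s - t != 0.
  rewrite subr_eq0; apply: contraTN Us => /eqP ->.
  by rewrite cat_uniq /= mem_head /= !andbF.
have IH s' t' y1' y2' : perm_eq [:: s'; t'] [:: s; t] ->
    perm_eq [:: y1'; y2'] [:: y1; y2] ->
    let rows' := r1 ++ [:: (s', (true, y1')), (t', (false, y2')) & r2] in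
    grid rows' A B = grid rows' (flip B) (flip A).
  move=> Pst Py; apply: IHg => //=; first by rewrite map_cat /= Eg1 Eg2.
    apply: etrans Us; rewrite map_cat /=; apply: perm_uniq.
    by rewrite perm_cat2l; apply: perm_cat Pst (perm_refl _).
  rewrite !map_cat; move: Ec; rewrite !count_cat /= => Ec.
  have /permP/(_ (pred1 true)) /= := Py.
  by move: Ec; case: y1' y2' y1 y2 {Py} => -[] [] [] /=; lia.
(* For NW labels 1, 0 the grid to be treated is the [d] term, with coefficient [s - t]. The other
   three grids have the sorted pair and are symmetric by [IH], so [s - t] can be cancelled. *)
have := grid_exchange r1 r2 s t true false y1 y2 A B.
have := grid_exchange r1 r2 s t true false y1 y2 (flip B) (flip A).
have -> : descent (bit_label true, bit_label false) by [].
have perm2C (T : eqType) (u v : T) : perm_eq [:: u; v] [:: v; u].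
  by rewrite (perm_catC [:: u] [:: v]).
by rewrite mulr1 !IH ?perm_refl ?perm2C //= => <- /addrI/(mulfI neq_st).
Qed.


(** * Change of coefficient ring *)

Section Morphism.
Variables (R S : comNzRingType) (f : {rmorphism R -> S}).

Lemma rmorph_kprod (X : finType) (T : Type) (g : T -> X -> X -> R) s x y :
  f (kprod [seq g i | i <- s] x y)
  = kprod [seq (fun u v => f (g i u v)) | i <- s] x y.
Proof.
elim: s x => [|i s IHs] x /=; first by rewrite rmorph_nat.
by rewrite rmorph_sum; apply: eq_bigr => z _; rewrite rmorphM IHs.
Qed.

Lemma rmorph_grid a (rows : seq (grid_row R)) (A B : {ffun 'I_a -> label}) :
  f (grid rows A B) = grid [seq (f w.1, w.2) | w <- rows] A B.
Proof.
rewrite /grid rmorph_kprod -map_comp; apply: eq_kprod => -[s [x y]] _ A' B' /=.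
rewrite /strip rmorph_kprod; apply: eq_kprod => i _ u v.
by rewrite /site rmorphD rmorphM !rmorph_nat.
Qed.

End Morphism.

(** * Puzzle counts as grid entries *)

Definition fuse (I J : finType) (X : Type) (F : {ffun J -> {ffun I -> X}}) :
  {ffun I * J -> X} := [ffun p => F p.2 p.1].

Lemma fuse_bij (I J : finType) (X : Type) : bijective (@fuse I J X).
Proof.
exists (fun F : {ffun I * J -> X} => [ffun j => [ffun i => F (i, j)]]) => F.
  by apply/ffunP => j; apply/ffunP => i; rewrite !ffunE.
by apply/ffunP => -[i j]; rewrite !ffunE.
Qed.

Section Counting.
Variables (R : comNzRingType) (a c : nat).
Implicit Types (alpha beta : a.-tuple bool) (gamma delta : c.-tuple bool).

(** [rev_ord] appears because the SE side is read from right to bottom, against [j]. *)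
Definition grid_boundary_rows gamma delta (s : 'I_c -> R) : seq (grid_row R) :=
  [seq (s j, (tnth gamma j, tnth delta (rev_ord j))) | j <- enum 'I_c].

Lemma grid_boundary_rowsE gamma delta s (A B : {ffun 'I_a -> label}) :
  grid (grid_boundary_rows gamma delta s) A B
  = kprod [seq strip (s j) (bit_label (tnth gamma j))
                 (bit_label (tnth delta (rev_ord j))) | j <- enum 'I_c] A B.
Proof. by rewrite /grid -map_comp. Qed.

Definition tuple_conf alpha : {ffun 'I_a -> label} :=
  [ffun i => bit_label (tnth alpha i)].

Lemma tuple_conf_binary alpha : is_binary (tuple_conf alpha).
Proof. by move=> i; rewrite ffunE; case: (tnth alpha i). Qed.

(** Once the [D] and [U] labels are fixed, the cells are filled independently, so the sum over
    diagonals factors. *)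
Lemma sum_diagonals (D : {ffun 'I_a * 'I_c.+1 -> label})
    (U : {ffun 'I_a.+1 * 'I_c -> label}) :
  \sum_H (is_puzzle (D, U, H))%:R
  = \prod_j \prod_i site 1 (D (i, widen_ord (leqnSn c) j)) (D (i, lift ord0 j))
      (U (widen_ord (leqnSn a) i, j)) (U (lift ord0 i, j)) :> R.
Proof.
pose ok (p : 'I_a * 'I_c) (h : option label) : bool :=
  let nw := U (widen_ord (leqnSn a) p.1, p.2) in
  let ne := D (p.1, lift ord0 p.2) in
  let se := U (lift ord0 p.1, p.2) in
  let sw := D (p.1, widen_ord (leqnSn c) p.2) in
  match h with
  | Some h => triangle_piece nw ne h && triangle_piece h se sw
  | None => equivariant_piece nw ne se sw
  end.
transitivity
  (\sum_(H : {ffun 'I_a * 'I_c -> option label}) \prod_p (ok p (H p))%:R : R).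
  apply: eq_bigr => H _.
  have -> : is_puzzle (D, U, H) = [forall p, ok p (H p)].
    have okE i j : cell_ok (D, U, H) i j = ok (i, j) (H (i, j)) by [].
    apply/forallP/forallP => okH; last first.
      by move=> i; apply/forallP => j; apply: (okH (i, j)).
    by case=> i j; rewrite -okE; move/forallP: (okH i).
  case: forallP => [okH|nok]; first by rewrite big1 // => p _; rewrite okH.
  have [p /negbTE np] : exists p, ~~ ok p (H p).
    by apply/existsP; rewrite -negb_forall; apply/forallP.
  by rewrite (bigD1 p) //= np mul0r.
rewrite -(bigA_distr_bigA (fun p h => (ok p h)%:R)) exchange_big pair_big /=.
apply: eq_bigr => -[i j] _.
by rewrite big_option_label /site natr_sum mul1r [RHS]addrC.
Qed.

(** The transfer matrix method: the [D] labels form a path of configurations from SW to NE, and for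
    a fixed path the [U] labels of distinct strips are independent. *)
Lemma ParT_grid alpha gamma beta delta :
  (ParT alpha gamma beta delta)%:R
  = grid (grid_boundary_rows gamma delta (fun=> 1)) (flip (tuple_conf alpha))
      (tuple_conf beta) :> R.
Proof.
rewrite grid_boundary_rowsE -kprod_paths.
pose bD (D' : {ffun 'I_c.+1 -> {ffun 'I_a -> label}}) :=
  (D' ord0 == flip (tuple_conf alpha)) && (D' ord_max == tuple_conf beta).
pose bU j (u : {ffun 'I_a.+1 -> label}) :=
  (u ord0 == bit_label (tnth gamma j))
  && (u ord_max == bit_label (tnth delta (rev_ord j))).
have bdE D' U' H : has_boundary (fuse D', fuse U', H) alpha gamma beta delta
    = bD D' && (U' \in family bU).
  apply/and4P/andP => [[/forallP b1 /forallP b2 /forallP b3 /forallP b4]|].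
    split.
      apply/andP; split; apply/eqP/ffunP => i; rewrite !ffunE.
        by have /eqP := b1 (rev_ord i); rewrite rev_ordK /edgeD /= ffunE.
      by have /eqP := b3 i; rewrite /edgeD /= ffunE.
    apply/familyP => j; rewrite unfold_in /bU.
    have := b2 j; rewrite /edgeU /= ffunE /= => ->.
    by have := b4 (rev_ord j); rewrite rev_ordK /edgeU /= ffunE.
  case=> /andP[/eqP D0 /eqP D1] /familyP bUU; split; apply/forallP => k.
  - by rewrite /edgeD /= ffunE /= D0 !ffunE rev_ordK.
  - by rewrite /edgeU /= ffunE /=; have := bUU k; rewrite unfold_in => /andP[].
  - by rewrite /edgeD /= ffunE /= D1 !ffunE.
  - rewrite /edgeU /= ffunE /=; have := bUU (rev_ord k).
    by rewrite unfold_in /bU rev_ordK => /andP[].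
rewrite /ParT cardsE -sum1_card natr_sum /=.
rewrite big_mkcond /=.
pose G D U H : R := ((is_puzzle (D, U, H))
  && has_boundary (D, U, H) alpha gamma beta delta)%:R.
transitivity (\sum_D \sum_U \sum_H G D U H).
  rewrite pair_big pair_big /=; apply: eq_bigr => -[[D U] H] _ /=.
  by rewrite /G unfold_in; case: (_ && _).
rewrite (reindex (@fuse _ _ label)) /=; last exact: onW_bij (@fuse_bij _ _ _).
rewrite [RHS]big_mkcond /=; apply: eq_bigr => D' _.
rewrite (reindex (@fuse _ _ label)) /=; last exact: onW_bij (@fuse_bij _ _ _).
under eq_bigr => U' _ do under eq_bigr => H _ do
  rewrite /G bdE andbC -mulnb natrM.
under eq_bigr => U' _ do rewrite -mulr_sumr sum_diagonals -mulnb natrM -mulrA.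
rewrite -mulr_sumr -/(bD D'); case: (bD D'); last by rewrite mul0r.
rewrite mul1r.
under [RHS]eq_bigr => j _ do rewrite /strip /= -kprod_paths.
rewrite (bigA_distr_big_dep bU) /= [RHS]big_mkcond /=.
apply: eq_bigr => U' _; case: (U' \in _); last by rewrite mul0r.
rewrite mul1r; apply: eq_bigr => j _; apply: eq_bigr => i _.
by rewrite !ffunE.
Qed.

(** A half turn of the parallelogram flips each strip and reverses the order of the strips. *)
Lemma natr_ParT_half_turn alpha gamma beta delta :
  (ParT alpha gamma beta delta)%:R = (ParT beta delta alpha gamma)%:R :> R.
Proof.
pose f j : {ffun 'I_a -> label} -> {ffun 'I_a -> label} -> R :=
  strip 1 (bit_label (tnth delta j)) (bit_label (tnth gamma (rev_ord j))).
have rev_rev_ord : [seq rev_ord j | j <- rev (enum 'I_c)] = enum 'I_c.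
  by rewrite map_rev -rev_enum_ord revK.
rewrite !ParT_grid -[tuple_conf alpha in RHS]flipK !grid_boundary_rowsE.
rewrite -[in RHS]rev_rev_ord -map_comp -(kprod_tr (fun j => f (rev_ord j))).
rewrite -(kprod_conj (fun j x y => f (rev_ord j) y x) _ _ _ (@flipK a)).
apply: eq_kprod => j _ A B; rewrite /f rev_ordK; exact: strip_flip.
Qed.

End Counting.

(** * Specialization of the weights and conclusion *)

Lemma natr_int_inj : injective (fun n : nat => n%:R : int).
Proof. by move=> m n /eqP; rewrite !natz => /eqP[]. Qed.

Lemma ParT_half_turn a c
    (alpha beta : a.-tuple bool) (gamma delta : c.-tuple bool) :
  ParT alpha gamma beta delta = ParT beta delta alpha gamma.
Proof. by apply: natr_int_inj; apply: natr_ParT_half_turn. Qed.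

Lemma ParT_swap a c
    (alpha beta : a.-tuple bool) (gamma delta : c.-tuple bool) :
  count_mem true gamma = count_mem true delta ->
  ParT alpha gamma beta delta = ParT beta gamma alpha delta.
Proof.
move=> Egd; apply: natr_int_inj.
pose rows := grid_boundary_rows gamma delta
  (fun j => 1 + (j : nat)%:R *: 'X : {poly int}).
have rows1 : [seq (horner_eval 0 w.1, w.2) | w <- rows]
             = grid_boundary_rows gamma delta (fun=> 1).
  rewrite -map_comp; apply: eq_map => j /=.
  by rewrite /horner_eval !hornerE.
rewrite !ParT_grid -rows1 -!rmorph_grid grid_flip ?flipK //.
(* The weights [1 + j X] are told apart by their coefficient of [X]. *)
- rewrite -map_comp map_inj_uniq ?enum_uniq // => i j /addrI /=.
  move=> /(congr1 (fun p : {poly int} => p`_1)).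
  by rewrite !coefZ coefX !mulr1 => /natr_int_inj/val_inj.
- have -> : [seq w.2.1 | w <- rows] = gamma by rewrite -map_comp map_tnth_enum.
  have -> : [seq w.2.2 | w <- rows] = rev delta.
    rewrite -[in RHS](map_tnth_enum delta) -map_rev rev_enum_ord.
    by rewrite -!map_comp.
  by rewrite count_rev.
- by apply/flip_binary/tuple_conf_binary.
- exact: tuple_conf_binary.
Qed.

Local Close Scope ring_scope.

Theorem corollary4 (a0 a1 c0 c1 : nat)
    (alpha beta : (a0 + a1).-tuple bool) (gamma delta : (c0 + c1).-tuple bool)
    (halpha : alpha \in binstr (a0 + a1) a1)
    (hbeta : beta \in binstr (a0 + a1) a1)
    (hgamma : gamma \in binstr (c0 + c1) c1)
    (hdelta : delta \in binstr (c0 + c1) c1) :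
  [/\ ParT alpha gamma beta delta = ParT beta gamma alpha delta,
      ParT beta gamma alpha delta = ParT alpha delta beta gamma
    & ParT alpha delta beta gamma = ParT beta delta alpha gamma].
Proof.
have Egd : count_mem true gamma = count_mem true delta.
  by move: hgamma hdelta; rewrite !inE => /eqP -> /eqP ->.
by split; [exact: ParT_swap | exact: ParT_half_turn | exact: ParT_swap].
Qed.
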